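(* Let $W$ be a simply laced finite Weyl group with nonempty set of simple reflections $\{s_i;i\in I\}$, longest element $w_0$ and $\nu=|w_0|$. Let $K$ be a subgroup $\ne\{0\}$ of the additive group $\mathbf{R}$, regarded as a semifield in which the semifield sum of $a,b$ is $\min(a,b)$ and the semifield product of $a,b$ is the usual sum $a+b$, and let $K_+=K\cap\mathbf{R}_{\ge0}$. Let $\mathbf{i}=(i_1,i_2,\dots,i_\nu)\in\mathcal{I}$ and let $H_1\in\mathcal{U}(K_+)$. Define successively, for $j=1,2,\dots,\nu$, $$c_j=z_{i_j}(H_j)\in K_+,\qquad H_{j+1}=T_{i_j}(-c_j)H_j\in\mathcal{U}(K_+).$$ Then $$H_1=T_{i_1}(c_1)T_{i_2}(c_2)\cdots T_{i_\nu}(c_\nu)\mathbf{H}.$$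
   Context: All formulas below use the usual operations $+$, $-$, $\min$ of real numbers. **Weyl group data.** For $i,j\in I$ put $i.j=-1$ if $i\ne j$ and $s_is_js_i=s_js_is_j$; $i.j=0$ if $i\neq j$ and $s_is_j=s_js_i$; $i.j=2$ if $i=j$. $|\cdot|$ is the length function on $W$; $\mathcal{I}$ is the set of all sequences $(i_1,\dots,i_\nu)$ in $I$ with $s_{i_1}s_{i_2}\cdots s_{i_\nu}=w_0$. **The monoid $\mathfrak{U}(K)$ and the sets $\mathcal{U}(K)$, $\mathcal{U}(K_+)$.** $\mathfrak{U}(K)$ is the monoid with generators $\{i^a;i\in I,a\in K\}$ ($i^a$ is a formal symbol) and relations: - $i^aj^b=j^bi^a$ if $i.j=0$, $a,b\in K$; - $i^aj^bi^c=j^{a'}i^{b'}j^{c'}$ if $i.j=-1$ and $a,b,c,a',b',c'\in K$ satisfy $a+b=b'+c'$, $a'+b'=b+c$, $b'=\min(a,c)$ (equivalently $b=\min(a',c')$); - $i^ai^b=i^{\min(a,b)}$ for $i\in I$, $a,b\in K$. For any $\mathbf{i}=(i_1,\dots,i_\nu)\in\mathcal{I}$ the map $f_{\mathbf{i}}:K^\nu\to\mathfrak{U}(K)$, $(a_1,\dots,a_\nu)\mapsto i_1^{a_1}i_2^{a_2}\cdots i_\nu^{a_\nu}$ is injective, and its image $\mathcal{U}(K)$ does not depend on $\mathbf{i}$. The subset $\mathcal{U}(K_+)=f_{\mathbf{i}}(K_+^\nu)$ of $\mathcal{U}(K)$ also does not depend on $\mathbf{i}$. **The maps $T_i(a)$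 and $z_i$.** For $i\in I$ and $a\in K$ there are well defined maps $T_i(a):\mathcal{U}(K)\to\mathcal{U}(K)$ and $z_i:\mathcal{U}(K)\to K$ such that for every $\mathbf{i}=(i_1,\dots,i_\nu)\in\mathcal{I}$ with $i_1=i$ and every $(a_1,\dots,a_\nu)\in K^\nu$, $$T_i(a)(i_1^{a_1}i_2^{a_2}\cdots i_\nu^{a_\nu})=i_1^{a_1+a}i_2^{a_2}\cdots i_\nu^{a_\nu},\qquad z_i(i_1^{a_1}i_2^{a_2}\cdots i_\nu^{a_\nu})=a_1.$$ **The element $\mathbf{H}$.** $\mathbf{H}=i_1^0i_2^0\cdots i_\nu^0\in\mathcal{U}(K_+)$ for any $(i_1,\dots,i_\nu)\in\mathcal{I}$; this is independent of the choice of sequence in $\mathcal{I}$. *)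

(* Defs.v *)
From HB Require Import structures.
From mathcomp Require Import all_boot all_order all_algebra all_fingroup.
From mathcomp Require Import boolp reals.

Set Implicit Arguments.
Unset Strict Implicit.
Unset Printing Implicit Defensive.

Import Order.TTheory GRing.Theory Num.Theory.

Local Open Scope ring_scope.
Local Open Scope quotient_scope.

(* A simply laced finite Weyl group is a finite Coxeter group in which the
   order of [s_i s_j], for distinct [i], [j], is 2 or 3.  The last field is the
   universal property of the Coxeter presentation; for [i = j] the relation
   imposed on [f] reads [f i ^+ 2 = 1] because [s_i s_i = 1] has order 1. *)
Record simply_laced_weyl (I : finType) (W : finGroupType) (s : I -> W) : Prop :=
  SimplyLacedWeyl {
    slw_gen : <<[set s i | i in I]>>%g = [set: W];
    slw_ord2 : forall i : I, #[s i]%g = 2%N;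
    slw_ord : forall i j : I, i != j -> #[(s i * s j)%g]%g = 2%N \/
                                        #[(s i * s j)%g]%g = 3%N;
    slw_univ : forall (G : groupType) (f : I -> G),
      (forall i j : I, ((f i * f j) ^+ #[s i * s j])%g = 1%g) ->
      exists phi : W -> G,
        {morph phi : x y / (x * y)%g >-> (x * y)%g} /\
        (forall i : I, phi (s i) = f i) }.

Definition word_prod (I : finType) (W : finGroupType) (s : I -> W)
  (ii : seq I) : W := (\prod_(i <- ii) s i)%g.

Lemma word_exists (I : finType) (W : finGroupType) (s : I -> W) :
  simply_laced_weyl s ->
  forall w : W, exists n : nat, [exists t : n.-tuple I, word_prod s t == w].
Proof.
move=> [gen _ _ _] w.
have : w \in <<[set s i | i in I]>>%g by rewrite gen inE.
case/gen_prodgP=> n [c Hc ->].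
have /fin_all_exists [g Hg] (k : 'I_n) : exists i : I, c k = s i.
  by have /imsetP[i _ ->] := Hc k; exists i.
exists n; apply/existsP; exists [tuple g k | k < n]; apply/eqP.
rewrite /word_prod big_tuple; apply: eq_bigr => k _.
by rewrite tnth_mktuple Hg.
Qed.

Definition len (I : finType) (W : finGroupType) (s : I -> W)
  (hW : simply_laced_weyl s) (w : W) : nat := ex_minn (word_exists hW w).

Definition is_longest (I : finType) (W : finGroupType) (s : I -> W)
  (hW : simply_laced_weyl s) (w0 : W) : Prop :=
  forall w : W, (len hW w <= len hW w0)%N.

(* Membership in the set of sequences [(i_1, ..., i_nu)], [nu = |w0|], with
   [s_(i_1) ... s_(i_nu) = w0]. *)
Definition is_word_of (I : finType) (W : finGroupType) (s : I -> W)
  (hW : simply_laced_weyl s) (w0 : W) (ii : seq I) : Prop :=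
  size ii = len hW w0 /\ word_prod s ii = w0.

(* The pairing [i.j]; in the simply laced case the last branch is reached
   exactly when [s i] and [s j] are distinct and commute. *)
Definition dot (I : finType) (W : finGroupType) (s : I -> W) (i j : I) : int :=
  if i == j then 2
  else if (s i * s j * s i)%g == (s j * s i * s j)%g then -1
  else 0.

Definition subK (R : realType) (K : zmodClosed R) : Type := {x : R | x \in K}.

HB.instance Definition _ (R : realType) (K : zmodClosed R) :=
  SubChoice.copy (subK K) {x : R | x \in K}.
HB.instance Definition _ (R : realType) (K : zmodClosed R) :=
  [SubChoice_isSubZmodule of subK K by <:].
HB.instance Definition _ (R : realType) (K : zmodClosed R) :=
  [SubChoice_isSubOrder of subK K by <: with ring_display].

Section Monoid.
Variables (I : finType) (W : finGroupType) (s : I -> W).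
Variables (R : realType) (K : zmodClosed R).

(* The pair [(i, a)] is the formal symbol [i^a]. *)
Definition fword : Type := seq (I * subK K).

Inductive urel : fword -> fword -> Prop :=
| urel_comm (i j : I) (a b : subK K) :
    dot s i j = 0 ->
    urel [:: (i, a); (j, b)] [:: (j, b); (i, a)]
| urel_braid (i j : I) (a b c a' b' c' : subK K) :
    dot s i j = -1 ->
    a + b = b' + c' -> a' + b' = b + c -> b' = Num.min a c ->
    urel [:: (i, a); (j, b); (i, c)] [:: (j, a'); (i, b'); (j, c')]
| urel_idem (i : I) (a b : subK K) :
    urel [:: (i, a); (i, b)] [:: (i, Num.min a b)].

Inductive ucong : fword -> fword -> Prop :=
| ucong_rel (x y : fword) : urel x y -> ucong x y
| ucong_refl (x : fword) : ucong x x
| ucong_sym (x y : fword) : ucong x y -> ucong y x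
| ucong_trans (x y z : fword) : ucong x y -> ucong y z -> ucong x z
| ucong_cat (x y x' y' : fword) :
    ucong x y -> ucong x' y' -> ucong (x ++ x') (y ++ y').

Definition ucongb : rel fword := fun x y => `[< ucong x y >].

Lemma ucongb_refl : reflexive ucongb.
Proof. by move=> x; apply/asboolP; apply: ucong_refl. Qed.

Lemma ucongb_sym : symmetric ucongb.
Proof. by move=> x y; apply/asboolP/asboolP; apply: ucong_sym. Qed.

Lemma ucongb_trans : transitive ucongb.
Proof.
move=> y x z /asboolP xy /asboolP yz; apply/asboolP.
exact: ucong_trans xy yz.
Qed.

Canonical ucong_equiv := EquivRel ucongb ucongb_refl ucongb_sym ucongb_trans.

Definition Umon : Type := {eq_quot ucong_equiv}.
HB.instance Definition _ := Choice.copy Umon {eq_quot ucong_equiv}.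

Definition ucls (x : fword) : Umon := \pi_{eq_quot ucong_equiv} x.
Definition urepr (u : Umon) : fword := generic_quotient.repr (u : {eq_quot ucong_equiv}).

Lemma ureprK (u : Umon) : ucls (urepr u) = u.
Proof. exact: reprK. Qed.

Lemma uclsP (x y : fword) : ucls x = ucls y <-> ucong x y.
Proof.
split; first by move/eqmodP/asboolP.
by move=> h; apply/eqmodP/asboolP.
Qed.

Definition umul (u v : Umon) : Umon := ucls (urepr u ++ urepr v).
Definition uone : Umon := ucls [::].

Lemma ucls_cat (x y : fword) : ucls (x ++ y) = umul (ucls x) (ucls y).
Proof.
by apply/uclsP; apply: ucong_cat; apply/uclsP; rewrite ureprK.
Qed.

Lemma umulA : associative umul.
Proof.
move=> u v w; rewrite -(ureprK u) -(ureprK v) -(ureprK w).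
by rewrite -!ucls_cat catA.
Qed.

Lemma umul1 : left_id uone umul.
Proof. by move=> u; rewrite -(ureprK u) -ucls_cat. Qed.

Lemma umulr1 : right_id uone umul.
Proof. by move=> u; rewrite -(ureprK u) -ucls_cat cats0. Qed.

HB.instance Definition _ := isMonoid.Build Umon umulA umul1 umulr1.

Definition ugen (i : I) (a : subK K) : Umon := ucls [:: (i, a)].

Variables (hW : simply_laced_weyl s) (w0 : W).

Definition umap (ii : seq I) (a : seq (subK K)) : Umon :=
  (\prod_(p <- zip ii a) ugen p.1 p.2)%g.

(* The subset of [Umon] formed by the products [i_1^(a_1) ... i_nu^(a_nu)];
   membership is stated with some sequence of
   [is_word_of], since the image of [K^nu] is the same for all of them. *)
Definition UK : Type :=
  {x : Umon | exists (ii : seq I) (a : (size ii).-tuple (subK K)),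
      is_word_of hW w0 ii /\ x = umap ii a}.

Definition fUK (ii : seq I) (hii : is_word_of hW w0 ii)
  (a : (size ii).-tuple (subK K)) : UK :=
  exist _ (umap ii a)
    (ex_intro _ ii (ex_intro _ a (conj hii (erefl (umap ii a))))).

Definition in_UKplus (x : UK) : Prop :=
  exists (ii : seq I) (hii : is_word_of hW w0 ii)
         (a : (size ii).-tuple (subK K)),
    (forall k : 'I_(size ii), 0 <= tnth a k) /\ x = fUK hii a.

(* The defining property of the maps [T_i(b)] and [z_i].  It determines both
   uniquely, because every element of [UK] can be written starting with any
   given [i]; it can be met because the maps [fUK hii] are injective and
   compatible under change of [ii]. *)
Definition is_Tz (T : I -> subK K -> UK -> UK) (z : I -> UK -> subK K) : Prop :=
  forall (i : I) (ii : seq I) (hii : is_word_of hW w0 (i :: ii))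
         (a1 : subK K) (a : (size ii).-tuple (subK K)),
    (forall b : subK K,
       T i b (fUK hii [tuple of a1 :: a]) = fUK hii [tuple of a1 + b :: a]) /\
    z i (fUK hii [tuple of a1 :: a]) = a1.

Definition Helt (ii : seq I) (hii : is_word_of hW w0 ii) : UK :=
  fUK hii [tuple of nseq (size ii) 0].

End Monoid.

Arguments UK {I W s R} K hW w0.
Arguments Helt {I W s R} K {hW w0 ii} hii.

(* Main.v *)
(** If [a >= 0] then [i^0 i^a = i^0] in the monoid, so on [U(K_+)] the map
    [H |-> T_i(- z_i(H)) H] is left multiplication by [i^0].  Hence
    [H_(nu+1) = h' H_1] with [h' = i_nu^0 ... i_1^0].  For every [i], [h'] can
    be rewritten so as to end with [i^0], so [h' i^a = h'] for [a >= 0] and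
    [h' H_1 = h']; symmetrically [i^0 H = H] for all [i], whence
    [h' = h' H = H].  Undoing the steps gives the formula for [H_1].

    The rewritings rest on the exchange condition for [W].  It is obtained from
    the Coxeter presentation by letting [W] act on [W * bool], [s_i] sending
    [(t, b)] to [(s_i t s_i, b (+) (t == s_i))]. *)
Require Import Defs.
From mathcomp Require Import all_boot all_order all_algebra all_fingroup.
From mathcomp Require Import boolp reals.
Import Order.TTheory GRing.Theory Num.Theory.
Local Open Scope ring_scope.

Set Implicit Arguments.
Unset Strict Implicit.
Unset Printing Implicit Defensive.

(** * Exchange condition and left descents in [W] *)

Section Descents.
Variables (I : finType) (W : finGroupType) (s : I -> W).
Hypothesis hW : simply_laced_weyl s.
Local Open Scope group_scope.

Lemma mulss i : s i * s i = 1.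
Proof. by rewrite -expg2 -(slw_ord2 hW i) expg_order. Qed.

Lemma mulKs i : cancel (mulg (s i)) (mulg (s i)).
Proof. by move=> w; rewrite mulgA mulss mul1g. Qed.

Lemma mulsK i : cancel (mulg^~ (s i)) (mulg^~ (s i)).
Proof. by move=> w; rewrite -mulgA mulss mulg1. Qed.

Lemma s_neq i j : i != j -> s i != s j.
Proof.
move=> nij; apply/eqP => eij.
have := slw_ord hW nij.
by rewrite eij mulss order1; case.
Qed.

Variant dot_spec i j : Prop :=
| DotBraid of s i * s j * s i = s j * s i * s j & dot s i j = (-1)%R &
    #[s i * s j] = 3%N
| DotComm of s i * s j = s j * s i & dot s i j = 0%R & #[s i * s j] = 2%N.

Lemma dotP i j : i != j -> dot_spec i j.
Proof.
move=> nij; have [o|o] := slw_ord hW nij; have := expg_order (s i * s j);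
  rewrite o !expgS expg0 mulg1 !mulgA.
  move=> /(congr1 (fun w => w * s j * s i)); rewrite mul1g !mulsK => e.
  (* When [s i] and [s j] commute, the braid test in [dot] amounts to [s j == s i], which fails. *)
  apply: DotComm => //; rewrite /dot (negPf nij) -e -[X in _ == X]mulgA mulss.
  by rewrite mulg1 e mulsK eq_sym (negPf (s_neq nij)).
move=> /(congr1 (fun w => w * s j * s i * s j)); rewrite mul1g !mulsK => e.
by apply: DotBraid => //; rewrite /dot (negPf nij) e eqxx.
Qed.

Definition sact i (p : W * bool) : W * bool :=
  (s i * p.1 * s i, p.2 (+) (p.1 == s i)).

Lemma conjs_eq i (t u : W) : (s i * t * s i == u) = (t == s i * u * s i).
Proof.
apply/eqP/eqP => [<-|->]; first by rewrite !mulgA mulss mul1g mulsK.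
by rewrite !mulgA mulss mul1g mulsK.
Qed.

Lemma sactK i : involutive (sact i).
Proof.
case=> t b; rewrite /sact /= conjs_eq mulss mul1g -addbA addbb addbF.
by rewrite !mulgA mulss mul1g mulsK.
Qed.

Definition sperm i : {perm W * bool} := perm (inv_inj (@sactK i)).

Lemma mulsp i : sperm i * sperm i = 1.
Proof. by apply/permP => p; rewrite permM !permE sactK. Qed.

Lemma spermK i : cancel (mulg^~ (sperm i)) (mulg^~ (sperm i)).
Proof. by move=> p; rewrite -mulgA mulsp mulg1. Qed.

(** Both sides of the braid relation flip the bit at the same three elements [s i], [s j] and
    [s i * s j * s i], in opposite orders; in the commuting case, at [s i] and [s j]. *)
Lemma sperm_rel i j : (sperm i * sperm j) ^+ #[s i * s j] = 1.
Proof.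
have [->|nij] := eqVneq i j.
  by rewrite mulss order1 expg1 mulsp.
case: (dotP nij) => e _ ->; rewrite !expgS expg0 mulg1.
  have pe : sperm i * sperm j * sperm i = sperm j * sperm i * sperm j.
    apply/permP => -[t b]; rewrite !permM !permE /sact /= !conjs_eq !mulgA.
    have -> : s i * s j * s i * s j * s i = s j by rewrite e !mulsK.
    have -> : s j * s i * s j * s i * s j = s i by rewrite -e !mulsK.
    have eM x : x * s i * s j * s i = x * s j * s i * s j.
      by rewrite -!mulgA (mulgA (s i)) e -!mulgA.
    by rewrite eM e; congr (_, _); rewrite addbAC (addbAC b) [RHS]addbAC.
  by rewrite !mulgA pe !spermK mulsp.
have pe : sperm i * sperm j = sperm j * sperm i.
  apply/permP => -[t b]; rewrite !permM !permE /sact /= !conjs_eq !mulgA.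
  have -> : s i * s j * s i = s j by rewrite e mulsK.
  have -> : s j * s i * s j = s i by rewrite -e mulsK.
  have eM x : x * s i * s j = x * s j * s i by rewrite -mulgA e mulgA.
  rewrite e eM.
  by rewrite -!addbA; congr (_, addb _ _); rewrite addbC.
by rewrite {2}pe !mulgA spermK mulsp.
Qed.

Local Notation wp := (word_prod s).
Local Notation len := (len hW).

Lemma word_prod_cons i u : wp (i :: u) = s i * wp u.
Proof. by rewrite /word_prod big_cons. Qed.

Lemma len_word u : (len (wp u) <= size u)%N.
Proof.
rewrite /len; case: ex_minnP => n _; apply.
by apply/existsP; exists (in_tuple u).
Qed.

Lemma reduced_word w : exists2 u, wp u = w & size u = len w.
Proof.
rewrite /len; case: ex_minnP => n /existsP[u /eqP <-] _.
by exists u; rewrite ?size_tuple.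
Qed.

Lemma len_mulsW i w : (len w <= (len (s i * w)).+1)%N.
Proof.
have [u eu <-] := reduced_word (s i * w).
by have := len_word (i :: u); rewrite word_prod_cons eu mulKs.
Qed.

Lemma inv_parity_exists : exists N : W -> W -> bool,
  (forall t, N 1 t = false) /\
  (forall i w t, N (s i * w) t = (t == s i) (+) N w (s i * t * s i)).
Proof.
have [phi [phiM phi_s]] := slw_univ hW sperm_rel.
have phi1 : phi 1 = 1 by apply: (mulIg (phi 1)); rewrite -phiM !mul1g.
(* The incoming bit is only added to, so it factors out of the action. *)
have phi_flip w t b : (phi w (t, b)).2 = b (+) (phi w (t, false)).2.
  have [u <- _] := reduced_word w.
  elim: u t b => [|i u IH] t b.
    by rewrite /word_prod big_nil phi1 !permE /= addbF.
  rewrite word_prod_cons phiM phi_s !permM !permE /sact /= IH [in RHS]IH.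
  by rewrite addbA.
exists (fun w t => (phi w (t, false)).2); split=> [t|i w t].
  by rewrite phi1 permE.
by rewrite phiM phi_s permM permE /sact /= phi_flip.
Qed.

(* For a reflection [t], the parity of the number of times [t] occurs among the
   reflections attached to the letters of any word for [w]. *)
Definition inv_parity : W -> W -> bool := sval (cid inv_parity_exists).

Lemma inv_parity1 t : inv_parity 1 t = false.
Proof. by rewrite /inv_parity; case: cid => N []. Qed.

Lemma inv_parityM i w t :
  inv_parity (s i * w) t = (t == s i) (+) inv_parity w (s i * t * s i).
Proof. by rewrite /inv_parity; case: cid => N []. Qed.

(** An odd count is nonzero, so [t] is the reflection attached to some letter [k]; multiplying by
    [t] on the left deletes that letter. *)
Lemma exchange u t : inv_parity (wp u) t ->
  exists u1 k u2, u = u1 ++ k :: u2 /\ t * wp u = wp (u1 ++ u2).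
Proof.
elim: u t => [|i u IH] t; first by rewrite /word_prod big_nil inv_parity1.
rewrite word_prod_cons inv_parityM; have [-> _|_ /IH] := eqVneq t (s i).
  by exists [::], i, u; rewrite mulKs.
case=> u1 [k [u2 [-> e]]]; exists (i :: u1), k, u2; split=> //.
by rewrite cat_cons word_prod_cons -e !mulgA mulss mul1g.
Qed.

Lemma inv_parity_gt i w : inv_parity w (s i) -> (len (s i * w) < len w)%N.
Proof.
have [u <- eu] := reduced_word w => /exchange[u1 [k [u2 [eu2 ->]]]].
by rewrite -eu eu2 (leq_ltn_trans (len_word _)) // !size_cat /= addnS.
Qed.

Lemma inv_parityE i w : inv_parity w (s i) = (len (s i * w) < len w)%N.
Proof.
apply/idP/idP; first exact: inv_parity_gt.
(* The parities of [w] and [s i * w] at [s i] are opposite, so one of the two elements is shortened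
   by [s i]. *)
apply: contraTT => nw; rewrite -leqNgt ltnW // -{1}(mulKs i w).
by rewrite inv_parity_gt // inv_parityM eqxx mulss mul1g (negPf nw).
Qed.

Lemma descents_lt i j w : i != j -> (len (s i * w) < len w)%N ->
  (len (s j * w) < len w)%N -> (len (s i * (s j * w)) < len (s j * w))%N.
Proof.
move=> nij li lj.
have [v ev sv] := reduced_word (s i * w).
have ew : w = wp (i :: v) by rewrite word_prod_cons ev mulKs.
(* Exchange for [s j] deletes a letter of [i :: v]. Deleting the leading [i] would force
   [s j = s i], so the deleted letter lies in [v] and [s j * w] still starts with [i]. *)
have := lj; rewrite -inv_parityE {1}ew => /exchange[[|k u1] [l [u2 [/=]]]].
  case=> _ <-; rewrite -ew ev => /mulIg e.
  by have := s_neq nij; rewrite e eqxx.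
case=> <- ev'; rewrite -ew word_prod_cons => e.
have lu : (len (wp (u1 ++ u2)) < len (s i * w))%N.
  by rewrite -sv ev' (leq_ltn_trans (len_word _)) // !size_cat /= addnS.
rewrite e mulKs -e (leq_trans lu) //.
by rewrite -ltnS (leq_trans li) // len_mulsW.
Qed.

(** Conjugating [s j] by [s i] and then by [s j] gives [s i], and no flip occurs on the way, so the
    parity of [s i * (s j * w)] at [s j] is that of [w] at [s i]. *)
Lemma descents_braid_lt i j w : i != j -> s i * s j * s i = s j * s i * s j ->
  (len (s i * w) < len w)%N ->
  (len (s j * (s i * (s j * w))) < len (s i * (s j * w)))%N.
Proof.
move=> nij e li; have nji : j != i by rewrite eq_sym.
rewrite -inv_parityE !inv_parityM (negPf (s_neq nji)).
have -> : s j * (s i * s j * s i) * s j = s i.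
  by rewrite e !mulgA mulss mul1g mulsK.
rewrite inv_parityE li addbT e -{2}[s j](mulKs i); apply/eqP.
rewrite mulKs -[X in _ <> X]mul1g => /mulIg/(congr1 (mulg (s j))).
by rewrite mulKs mulg1 => /eqP; rewrite (negPf (s_neq nij)).
Qed.

End Descents.

(** * Bringing a descent to the front of a reduced word with exponents *)

Section StartWith.
Variables (I : finType) (W : finGroupType) (s : I -> W).
Variables (R : realType) (K : zmodClosed R).
Hypothesis hW : simply_laced_weyl s.
Implicit Types (x y : fword I K) (a b c : subK K).

Local Notation wp := (word_prod s).
Local Notation len := (len hW).

Lemma ucong_catl u x y : ucong s x y -> ucong s (u ++ x) (u ++ y).
Proof. by apply: ucong_cat; apply: ucong_refl. Qed.

Lemma ucong_catr u x y : ucong s x y -> ucong s (x ++ u) (y ++ u).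
Proof. by move/ucong_cat; apply; apply: ucong_refl. Qed.

Lemma ucong_cons p x y : ucong s x y -> ucong s (p :: x) (p :: y).
Proof. exact: (@ucong_catl [:: p]). Qed.

(** Each relation is stable under reversal; in the braid relation [a], [c] and [a'], [c'] trade
    places. *)
Lemma ucong_rev x y : ucong s x y -> ucong s (rev x) (rev y).
Proof.
elim=> {x y} [x y []|x|x y _|x y z _ + _|x y x' y' _ + _].
- by move=> i j a b d; rewrite /rev /=; apply/ucong_sym/ucong_rel/urel_comm.
- move=> i j a b c a' b' c' d e1 e2 e3; rewrite /rev /=; apply/ucong_rel.
  apply: (urel_braid d); last by rewrite e3 minC.
    by rewrite addrC -e2 addrC.
  by rewrite addrC -e1 addrC.
- by move=> i a b; rewrite /rev /= minC; apply/ucong_rel/urel_idem.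
- exact: ucong_refl.
- exact: ucong_sym.
- exact: ucong_trans.
by rewrite !rev_cat => h h'; apply: ucong_cat.
Qed.

Lemma reduced_behead p x : size (p :: x) = len (wp (unzip1 (p :: x))) ->
  size x = len (wp (unzip1 x)).
Proof.
move=> e; apply/eqP; rewrite eqn_leq -ltnS -[(size x).+1]/(size (p :: x)) e.
rewrite /= word_prod_cons -{1}[wp (unzip1 x)](mulKs hW p.1).
rewrite (leq_trans (len_mulsW hW p.1 _)) ?mulKs //.
by rewrite -(size_map fst) len_word.
Qed.

(** A braid move turns exponents [a], [b], [c] into [c + b - min a c], [min a c], [a + b - min a c];
    the first is covered by exchanging [a] and [c]. *)
Definition braid_closed (D : pred (subK K)) : Prop :=
  forall a b c, D a -> D b -> D c ->
    D (Num.min a c) && D (a + b - Num.min a c).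

Variable D : pred (subK K).
Hypothesis hD : braid_closed D.

Local Notation allD := (all (fun p : I * subK K => D p.2)).

(** Induction on the length: if the first letter is some [j] other than [i], then [i] is a descent
    of the tail and is brought to its front; one commutation or braid move then puts it first. *)
Lemma start_with i x : size x = len (wp (unzip1 x)) -> allD x ->
  (len (s i * wp (unzip1 x)) < len (wp (unzip1 x)))%N ->
  exists a y, [/\ ucong s x ((i, a) :: y),
    wp (unzip1 x) = s i * wp (unzip1 y), size x = (size y).+1,
    D a & allD y]%g.
Proof.
have [n] := ubnP (size x); elim: n x i => // n IH [|[j b] x] i lt_n red.
  by rewrite -red.
move=> /= /andP[Db Dx] li; have red' := reduced_behead red.
have [<-|nji] := eqVneq j i.
  by exists b, x; split=> //; [apply: ucong_refl|rewrite word_prod_cons].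
have nij : i != j by rewrite eq_sym.
set w := wp (unzip1 x) in red' *.
rewrite /= word_prod_cons -/w in red li *.
have lj : (len (s j * (s j * w)) < len (s j * w))%N.
  by rewrite (mulKs hW) -red -red'.
have := descents_lt nij li lj; rewrite (mulKs hW) => li'.
have [a [y [xy wy sy Da Dy]]] := IH _ _ lt_n red' Dx li'.
have {}xy := ucong_cons (j, b) xy.
case: (dotP hW nji) => [e d _|e d _]; last first.
  exists a, ((j, b) :: y); split=> //=; rewrite ?Db ?sy //.
    apply: ucong_trans xy _; apply: (@ucong_catr y [:: _; _] [:: _; _]).
    exact/ucong_rel/urel_comm.
  by rewrite word_prod_cons [w]wy !mulgA e.
have redy : size y = len (wp (unzip1 y)).
  by apply: (reduced_behead (p := (i, a))); rewrite /= word_prod_cons -wy -sy.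
(* In the braid case [j] is a descent of [y], so the word becomes [j i j] followed by [v]. *)
have lj' := descents_braid_lt nij (esym e) li.
rewrite (mulKs hW) [w]wy (mulKs hW) in lj'.
have lt_y : (size y < n)%N by rewrite -ltnS -sy ltnW.
have [c [v [yv wv sv Dc Dv]]] := IH _ _ lt_y redy Dy lj'.
set m := Num.min b c.
exists (a + c - m), ((j, m) :: (i, b + a - m) :: v).
have /andP[Dm Dl] := hD Db Da Dc.
have /andP[_ Dr] := hD Dc Da Db.
split; rewrite /= ?sy ?sv //.
- apply: ucong_trans xy _; have /(ucong_cons (i, a))/(ucong_cons (j, b)) := yv.
  move=> /ucong_trans; apply.
  apply: (@ucong_catr v [:: _; _; _] [:: _; _; _]).
  by apply/ucong_rel/urel_braid => //; rewrite 1?[m + _]addrC addrNK.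
- by rewrite !word_prod_cons [w]wy wv !mulgA e.
- by rewrite (addrC a) /m minC.
- by rewrite Dm Dl Dv.
Qed.

End StartWith.

(** * Words for [w0]: absorption by zero words, and one step of the recursion *)

Section Longest.
Variables (I : finType) (W : finGroupType) (s : I -> W).
Variables (R : realType) (K : zmodClosed R).
Variables (hW : simply_laced_weyl s) (w0 : W).
Hypothesis hw0 : is_longest hW w0.
Implicit Types (x y : fword I K) (u v : seq I).

Local Notation is_word := (is_word_of hW w0).
Local Notation wp := (word_prod s).

Definition zero_word u : fword I K := [seq (i, 0) | i <- u].

Lemma unzip1_zero_word u : unzip1 (zero_word u) = u.
Proof. by rewrite /unzip1 -map_comp map_id. Qed.

Lemma subK_ge0 (a : subK K) : (0 <= a) = (0 <= val a).
Proof. by rewrite -Order.le_val raddf0. Qed.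

Lemma braid_closed_ge0 : braid_closed (fun a : subK K => 0 <= a).
Proof.
move=> a b c a0 b0 c0; apply/andP; split; first by rewrite le_min a0 c0.
have [ac|ca] := leP a c; first by rewrite addrAC subrr add0r.
rewrite subK_ge0 raddfB raddfD addrAC addr_ge0 ?subr_ge0 -?subK_ge0 //.
by rewrite Order.le_val ltW.
Qed.

Lemma braid_closed_eq0 : braid_closed (pred1 (0 : subK K)).
Proof.
by move=> a b c /= /eqP-> /eqP-> /eqP->; rewrite minxx addr0 subr0 eqxx.
Qed.

Lemma start_with_longest (D : pred (subK K)) i x : braid_closed D ->
  is_word (unzip1 x) -> all (fun p : I * subK K => D p.2) x ->
  exists a y, [/\ ucong s x ((i, a) :: y), is_word (i :: unzip1 y),
    D a & all (fun p : I * subK K => D p.2) y].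
Proof.
move=> hD [sx wx] Dx.
have red : size x = len hW (wp (unzip1 x)) by rewrite wx -sx size_map.
have li : (len hW (s i * wp (unzip1 x)) < len hW (wp (unzip1 x)))%N.
  have := hw0 (s i * w0)%g; rewrite wx leq_eqVlt => /orP[/eqP e|//].
  (* Equal lengths are impossible: [s i] shortens either [w0] or [s i * w0]. *)
  rewrite -inv_parityE; apply/negPn/negP => np.
  have : inv_parity hW (s i * w0)%g (s i).
    by rewrite inv_parityM eqxx mulss // mul1g (negPf np).
  by rewrite inv_parityE mulKs // e ltnn.
have [a [y [xy wy sy Da Dy]]] := start_with hD red Dx li.
exists a, y; split=> //; split; last by rewrite word_prod_cons -wy wx.
by rewrite /= size_map -sy -sx size_map.
Qed.

Lemma zero_word_start u i : is_word u ->
  exists x, ucong s (zero_word u) ((i, 0) :: x).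
Proof.
move=> hu; have := @start_with_longest _ i (zero_word u) braid_closed_eq0.
rewrite unzip1_zero_word => /(_ hu)[|a [y [uy _ /eqP a0 _]]].
  by apply/allP => p /mapP[j _ ->] /=.
by exists y; rewrite -a0.
Qed.

(** The word of [v] can be made to start with any [i^0], and [i^0 i^0 = i^0]. *)
Lemma zero_word_absorbl u v : is_word v ->
  ucong s (zero_word u ++ zero_word v) (zero_word v).
Proof.
move=> hv; elim: u => [|i u IH] /=; first exact: ucong_refl.
apply: ucong_trans (ucong_cons _ IH) _; have [y vy] := zero_word_start i hv.
apply: ucong_trans (ucong_cons _ vy) (ucong_trans _ (ucong_sym vy)).
apply: (@ucong_catr _ _ _ _ _ y [:: _; _] [:: _]).
by rewrite -{3}[0](minxx 0); apply/ucong_rel/urel_idem.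
Qed.

Lemma rev_zero_word_absorbr u x : is_word u ->
  all (fun p : I * subK K => 0 <= p.2) x ->
  ucong s (rev (zero_word u) ++ x) (rev (zero_word u)).
Proof.
move=> hu; elim: x => [|[i a] x IH] /=.
  by move=> _; rewrite cats0; apply: ucong_refl.
case/andP=> a0 /IH; apply: ucong_trans.
rewrite -cat_rcons; apply: ucong_catr.
have [y uy] := zero_word_start i hu.
have {}uy := ucong_rev uy; rewrite rev_cons in uy.
rewrite -cats1.
apply: ucong_trans (ucong_catr _ uy) (ucong_trans _ (ucong_sym uy)).
rewrite cats1 -!cats1 -catA; apply: ucong_catl.
by rewrite -{2}(min_l a0); apply/ucong_rel/urel_idem.
Qed.

(** The concatenation of the two words is congruent to each of them, by absorption from either
    side. *)
Lemma rev_zero_word u v : is_word u -> is_word v ->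
  ucong s (rev (zero_word u)) (zero_word v).
Proof.
move=> hu hv; have := zero_word_absorbl (rev u) hv.
rewrite {1}/zero_word map_rev; apply: ucong_trans; apply: ucong_sym.
apply: rev_zero_word_absorbr => //.
by apply/allP => p /mapP[j _ ->] /=.
Qed.

Lemma umapE u (a : seq (subK K)) : umap s u a = ucls s (zip u a).
Proof.
rewrite /umap; elim: (zip u a) => [|p x IH]; first by rewrite big_nil.
by rewrite big_cons IH -[p :: x]cat1s ucls_cat; case: p.
Qed.

Lemma UK_eq (p q : UK K hW w0) : sval p = sval q -> p = q.
Proof.
case: p q => [p hp] [q hq] /= e; move: hp; rewrite e => hp.
by congr exist; apply: Prop_irrelevance.
Qed.

Lemma zip_ge0 u (a : (size u).-tuple (subK K)) :
  (forall k, 0 <= tnth a k) ->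
  all (fun p : I * subK K => 0 <= p.2) (zip u a).
Proof.
move=> a0; rewrite -(all_map snd (fun b => 0 <= b)) -/(unzip2 _).
by rewrite unzip2_zip ?size_tuple //; apply/all_tnthP.
Qed.

(** Brings [i] to the front with nonnegative exponents, the form on which [is_Tz] describes [T i]
    and [z i]. *)
Lemma UKplusP (p : UK K hW w0) i : in_UKplus p ->
  exists v (hv : is_word (i :: v)) a (b : (size v).-tuple (subK K)),
    [/\ 0 <= a, forall k, 0 <= tnth b k & p = fUK hv [tuple of a :: b]].
Proof.
case=> u [hu [a [a0 ->]]].
have x1 : unzip1 (zip u a) = u by rewrite unzip1_zip ?size_tuple.
have := start_with_longest i braid_closed_ge0 _ (zip_ge0 a0).
rewrite x1 => /(_ hu)[b [y [xy hy b0 y0]]].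
have sy : size (unzip2 y) == size (unzip1 y) by rewrite !size_map.
exists (unzip1 y), hy, b, (Tuple sy); split=> //.
  by apply/all_tnthP; rewrite /= all_map.
apply: UK_eq; rewrite /= !umapE /= zip_unzip.
exact/uclsP.
Qed.

(** If [p] starts with [i^a], then [q] has [i^0] there instead; since [i^0 i^a = i^0] for [0 <= a],
    [q] is [i^0] times [p]. *)
Lemma Tz_step T z i (p : UK K hW w0) (q := T i (- z i p) p) :
  is_Tz T z -> in_UKplus p ->
  [/\ 0 <= z i p, in_UKplus q, T i (z i p) q = p &
      forall x, sval p = ucls s x -> sval q = ucls s ((i, 0) :: x)].
Proof.
move=> hTz /(UKplusP i)[v [hv [a [b [a0 b0 ep]]]]].
have [Tp zp] := hTz i v hv a b.
have eq : q = fUK hv [tuple of 0 :: b].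
  by rewrite /q ep zp Tp; congr fUK; apply/val_inj; rewrite /= subrr.
split; first by rewrite ep zp.
- exists (i :: v), hv, [tuple of 0 :: b]; split=> //.
  by apply/all_tnthP => /=; rewrite lexx; apply/all_tnthP.
- have [Tq _] := hTz i v hv 0 b.
  by rewrite eq ep zp Tq; apply: UK_eq => /=; rewrite add0r.
move=> x; rewrite eq ep /= !umapE => /uclsP/ucong_sym/(ucong_cons (i, 0)) e.
apply/uclsP/ucong_sym/(ucong_trans e).
apply: (@ucong_catr _ _ _ _ _ (zip v b) [:: _; _] [:: _]).
by rewrite -{2}(min_l a0); apply/ucong_rel/urel_idem.
Qed.

End Longest.

(** * Iterating the steps and undoing them *)

Lemma foldr_enum_ord (A : Type) n (g : 'I_n -> A -> A) (h : nat -> A) :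
  (forall j : 'I_n, g j (h j.+1) = h j) -> foldr g (h n) (enum 'I_n) = h 0%N.
Proof.
elim: n g h => [|n IH] g h gh; first by rewrite enum_ord0.
(* Index 0 is applied last; the remaining indices form the same problem for the shifted sequence. *)
rewrite enum_ordSl /= foldr_map (IH _ (h \o S)) => [|j]; first exact: (gh ord0).
exact: (gh (lift ord0 j)).
Qed.

Theorem theorem13
  (I : finType) (W : finGroupType) (s : I -> W)
  (hI : (0 < #|I|)%N)
  (hW : simply_laced_weyl s)
  (w0 : W) (hw0 : is_longest hW w0)
  (nu : nat) (hnu : nu = len hW w0)
  (R : realType) (K : zmodClosed R)
  (hK : exists2 x : R, x \in K & x != 0)
  (T : I -> subK K -> UK K hW w0 -> UK K hW w0)
  (z : I -> UK K hW w0 -> subK K)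
  (hTz : is_Tz T z)
  (ii : nu.-tuple I) (hii : is_word_of hW w0 ii)
  (H1 : UK K hW w0) (hH1 : in_UKplus H1)
  (* [H j] and [c j] are the terms of index [j + 1] of the two sequences *)
  (H : nat -> UK K hW w0) (c : 'I_nu -> subK K)
  (hH0 : H 0%N = H1)
  (hc : forall j : 'I_nu, c j = z (tnth ii j) (H j))
  (hH : forall j : 'I_nu, H j.+1 = T (tnth ii j) (- c j) (H j)) :
  (forall j : 'I_nu, 0 <= c j /\ in_UKplus (H j.+1)) /\
  (forall (jj : seq I) (hjj : is_word_of hW w0 jj),
     H1 = foldr (fun (j : 'I_nu) (x : UK K hW w0) => T (tnth ii j) (c j) x)
                (Helt K hjj) (enum 'I_nu)).
Proof.
have Hpos j : (j <= nu)%N -> in_UKplus (H j).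
  elim: j => [|j IH] lt_j; first by rewrite hH0.
  rewrite (hH (Ordinal lt_j)) hc.
  by have [] := Tz_step hw0 (tnth ii (Ordinal lt_j)) hTz (IH (ltnW lt_j)).
have step (j : 'I_nu) :=
  Tz_step hw0 (tnth ii j) hTz (Hpos j (ltnW (ltn_ord j))).
split=> [j|jj hjj].
  by rewrite hc; split; [case: (step j)|apply: Hpos].
have [u [hu [a [a0 eH1]]]] := hH1.
(* Each step multiplies by a zero power on the left, so the letters used so far appear in reverse
   order. *)
have Hval j : (j <= nu)%N ->
    sval (H j) = ucls s (rev (zero_word K (take j ii)) ++ zip u a).
  elim: j => [|j IH] lt_j; first by rewrite take0 hH0 eH1 /= umapE.
  have [_ _ _ /(_ _ (IH (ltnW lt_j)))] := step (Ordinal lt_j).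
  (* Only a default value for [nth]. *)
  have i0 := tnth ii (Ordinal lt_j).
  rewrite -hc -hH (tnth_nth i0) /= => ->; rewrite (take_nth i0) ?size_tuple //.
  by rewrite /zero_word map_rcons rev_rcons.
(* After all steps the reversed zero word absorbs the word of [H1] and equals the zero word of
   [jj]. *)
have Hnu : H nu = Helt K hjj.
  apply: UK_eq; rewrite Hval // take_oversize ?size_tuple //= umapE.
  have -> : zip jj (nseq (size jj) 0) = zero_word K jj.
    by elim: (jj) => //= i v ->.
  apply/uclsP; apply: ucong_trans _ (rev_zero_word K hw0 hii hjj).
  exact: (rev_zero_word_absorbr hw0 hii (zip_ge0 a0)).
rewrite -Hnu foldr_enum_ord // => j.
by rewrite hH hc; case: (step j).
Qed.
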